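(* Let $p\in\mathbb{N}$, $\alpha,\beta>-1$, $x\in(0,1)$, and let $a_1,\dots,a_p,b_1,\dots,b_p$ be real numbers such that $$0<a_1\le\dots\le a_p,\qquad 0<b_1\le\dots\le b_p,\qquad \sum_{j=1}^k b_j-\sum_{j=1}^k a_j\ge0\quad\text{for }k=1,\dots,p.$$ For $A>0$ let $$W(A)=\int_0^\infty\prod_{i=1}^p\frac{\Gamma(At+a_i)}{\Gamma(At+b_i)}\;\frac{x^{t+\alpha}t^\beta}{\Gamma(\beta+1)}\,dt .$$ Then the function $A\mapsto W(A)$ is log-convex on $(0,\infty)$. Furthermore, the Turán type inequality $$W(A)\,W(A+2)-\big(W(A+1)\big)^2\ge 0$$ holds for all $A>0$.
   Context: $W(A)$ is the generalized Volterra function $V_{p,p}^{\alpha,\beta}$ at $x$ with upper parameters $(a_i,A)_{1\le i\le p}$ and lower parameters $(b_i,A)_{1\le i\le p}$ (all scale parameters equal to $A$). A positive function $f$ is log-convex if $\log f$ is convex. *)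

(* Defs.v *)
From HB Require Import structures.
From mathcomp Require Import all_boot all_order all_algebra.
From mathcomp Require Import all_classical all_reals all_analysis.

Set Implicit Arguments.
Unset Strict Implicit.
Unset Printing Implicit Defensive.

Import Order.TTheory GRing.Theory Num.Theory.
Import numFieldNormedType.Exports.

Local Open Scope classical_set_scope.
Local Open Scope ring_scope.

(* Euler's integral; it is the Gamma function for [0 < z] only (for other real
   [z] the integral diverges and [Rintegral] returns 0). *)
Definition Gamma (R : realType) (z : R) : R :=
  Rintegral (@lebesgue_measure R) `]0, +oo[
    (fun t => t `^ (z - 1) * expR (- t)).

(* The generalized Volterra function $V_{p,p}^{\alpha,\beta}$ at [x], with all
   scale parameters equal to [A].  The integrand is nonnegative for [0 < x] and
   [-1 < beta], and [Rintegral] returns 0 on an infinite integral, so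
   [0 < volterra a b alpha beta x A] includes the convergence of the integral. *)
Definition volterra (R : realType) (p : nat) (a b : 'I_p -> R)
    (alpha beta x A : R) : R :=
  Rintegral (@lebesgue_measure R) `]0, +oo[
    (fun t => (\prod_(i < p) (Gamma (A * t + a i) / Gamma (A * t + b i))) *
              (x `^ (t + alpha) * t `^ beta / Gamma (beta + 1))).

Definition log_convex (R : realType) (D : set R) (f : R -> R) : Prop :=
  (forall y, D y -> 0 < f y) /\ convex_function D (fun y => ln (f y)).

(* Main.v *)
Require Import Defs.
From HB Require Import structures.
From mathcomp Require Import all_boot all_order all_algebra.
From mathcomp Require Import all_classical all_reals all_analysis.
From mathcomp Require Import measurable_realfun.
From mathcomp Require Import ring lra.

(* Since Gamma is log-convex and Gamma(z + 1) = z Gamma(z), Gauss' limit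
   ln Gamma(y) = lim (ln Gamma(n) + y ln n - sum_(k < n) ln (y + k)) holds, so
   convexity in s of ln prod_i Gamma(s + a_i) / Gamma(s + b_i) reduces to
   concavity of sum_i (ln (s + a_i) - ln (s + b_i)).  The hypothesis on partial
   sums is weak supermajorization, which gives this concavity because, for
   w = l s + (1 - l) t, the function
   y |-> ln (w + y) - l ln (s + y) - (1 - l) ln (t + y) is convex and
   nonincreasing.  In the same way y |-> ln (t + y) - ln (s + y), with s <= t,
   shows that the Gamma ratio is nonincreasing, hence bounded by its value at 0,
   so that W(A) is finite.  Hoelder's inequality transfers log-convexity from
   the integrand to W, and the Turan inequality is the case l = 1/2. *)

Set Implicit Arguments.
Unset Strict Implicit.
Unset Printing Implicit Defensive.

Import Order.TTheory GRing.Theory Num.Theory.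
Import numFieldNormedType.Exports.

Local Open Scope classical_set_scope.
Local Open Scope ring_scope.

(** * Integrals over the positive half-line *)

Section integral_0y.
Context {R : realType}.
Implicit Types (f g h F : R -> R).
Local Notation mu := (@lebesgue_measure R).

Lemma continuous_measurable_fun_0y f :
  (forall t : R, 0 < t -> {for t, continuous f}) -> measurable_fun `](0 : R), +oo[ f.
Proof.
move=> fc; apply: measurable_realfun.open_continuous_measurable_fun => // t.
by rewrite inE/= in_itv/= andbT; exact: fc.
Qed.

(** An exhaustion of the open half-line by compact intervals on which the fundamental theorem of
    calculus applies; the offset 2 makes the endpoints distinct already at [n = 0]. *)
Let Itr (n : nat) : set R := `[n.+2%:R^-1, n.+2%:R].

Let Itr_gt0 n t : Itr n t -> 0 < t.
Proof. by rewrite /Itr/= in_itv/= => /andP[+ _]; apply: lt_le_trans; rewrite invr_gt0. Qed.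

Let bigcup_Itr : \bigcup_n Itr n = `]0, +oo[%classic.
Proof.
apply/seteqP; split=> [t [n _ /Itr_gt0]|t]; first by rewrite /= in_itv/= andbT.
rewrite /= in_itv/= andbT => t0.
have [n tn] : exists n : nat, Num.max t t^-1 <= n%:R.
  by exists (Num.trunc (Num.max t t^-1)).+1; rewrite ltW// truncnS_gt.
exists n => //; rewrite /Itr/= in_itv/=.
have n2 : n%:R <= n.+2%:R :> R by rewrite ler_nat -addn2 leq_addr.
move: tn; rewrite ge_max => /andP[tn Vtn].
rewrite (le_trans tn n2) andbT -[leRHS]invrK lef_pV2 ?posrE ?invr_gt0//.
exact: le_trans Vtn n2.
Qed.

Let nondecreasing_Itr : nondecreasing_seq Itr.
Proof.
apply/nondecreasing_seqP => n; rewrite subsetEset /Itr.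
apply: subset_itv; rewrite bnd_simp ?ler_nat//.
by rewrite lef_pV2 ?posrE// ler_nat.
Qed.

Let Itr_FTC F f n : (forall t : R, 0 < t -> is_derive t 1 F (f t)) ->
  (forall t : R, 0 < t -> {for t, continuous f}) ->
  (\int[mu]_(t in Itr n) (f t)%:E = (F n.+2%:R - F n.+2%:R^-1)%:E)%E.
Proof.
move=> dF cf; rewrite EFinB /Itr.
have cF t : 0 < t -> {for t, continuous F}.
  by move=> t0; apply: differentiable_continuous; apply/derivable1_diffP; have [] := dF t t0.
have n0 : 0 < n.+2%:R^-1 :> R by rewrite invr_gt0.
have gt0 t : t \in `[n.+2%:R^-1, n.+2%:R]%R -> 0 < t :> R.
  by rewrite in_itv/= => /andP[+ _]; exact: lt_le_trans.
apply: continuous_FTC2.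
- by rewrite (@lt_trans _ _ 1)// ?ltr1n// invf_lt1// ltr1n.
- apply: continuous_in_subspaceT => t; rewrite inE/= => /gt0; exact: cf.
- split.
  + move=> t /subset_itv_oo_cc /gt0 t0; by have [] := dF t t0.
  + by apply: cvg_at_right_filter; apply: cF.
  + by apply: cvg_at_left_filter; apply: cF.
- move=> t /subset_itv_oo_cc /gt0 t0; rewrite derive1E; by have [] := dF t t0.
Qed.

(** Monotone convergence along [Itr]: the integral of [f] over [Itr n] is a difference of two values
    of [F] in [[0, M]], hence at most [M]. *)
Lemma bounded_antiderivative_integrable_0y F f (M : R) :
  (forall t : R, 0 < t -> is_derive t 1 F (f t)) ->
  (forall t : R, 0 < t -> {for t, continuous f}) ->
  (forall t : R, 0 < t -> 0 <= f t) -> (forall t : R, 0 < t -> 0 <= F t <= M) ->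
  mu.-integrable `]0, +oo[ (EFin \o f).
Proof.
move=> dF cf f0 FM; have mf := continuous_measurable_fun_0y cf.
apply/integrableP; split; first exact/measurable_EFinP.
apply: (@le_lt_trans _ _ M%:E); last exact: ltry.
have -> : (\int[mu]_(t in `]0%R, +oo[) `|(EFin \o f) t| =
           \int[mu]_(t in `]0%R, +oo[) (f t)%:E)%E.
  by apply: eq_integral => t; rewrite inE/= in_itv/= andbT => t0; rewrite ger0_norm// f0.
rewrite -bigcup_Itr.
have mItr i : measurable (Itr i : set (measurableTypeR R)) by rewrite /Itr.
have mfItr i : measurable_fun (Itr i) (EFin \o f).
  apply/measurable_EFinP; apply: measurable_funS mf => //.
  by rewrite -bigcup_Itr; exact: bigcup_sup.
have f0Itr i t : Itr i t -> (0 <= (EFin \o f) t)%E.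
  by move=> /Itr_gt0 /f0; rewrite /= lee_fin.
have /cvg_lim <- // := ge0_nondecreasing_set_cvg_integral
  (mu := lebesgue_measure) nondecreasing_Itr mItr mfItr f0Itr.
apply: lime_le.
  apply: ereal_nondecreasing_is_cvgn.
  exact: ge0_nondecreasing_set_nondecreasing_integral.
apply: nearW => n; rewrite (@Itr_FTC F)// lee_fin.
have /andP[_ h1] : 0 <= F n.+2%:R <= M by apply: FM.
have /andP[h2 _] : 0 <= F n.+2%:R^-1 <= M by apply: FM; rewrite invr_gt0.
lra.
Qed.

(** Dominated convergence along [Itr], with dominating function [|f|]; the truncated integrals are
    boundary terms of [F], which tend to 0. *)
Lemma Rintegral_derive_eq0 F f :
  (forall t : R, 0 < t -> is_derive t 1 F (f t)) ->
  (forall t : R, 0 < t -> {for t, continuous f}) ->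
  mu.-integrable `]0, +oo[ (EFin \o f) ->
  F n.+2%:R @[n --> \oo] --> (0 : R) -> F n.+2%:R^-1 @[n --> \oo] --> (0 : R) ->
  \int[mu]_(t in `]0, +oo[) f t = 0.
Proof.
move=> dF cf fi Fy F0; have mf := continuous_measurable_fun_0y cf.
have ItrS n : Itr n `<=` `]0, +oo[ by rewrite -bigcup_Itr; exact: bigcup_sup.
have mItr n : measurable (Itr n) by rewrite /Itr.
have mfItr n : measurable_fun `](0 : R), +oo[ ((EFin \o f) \_ (Itr n)).
  apply/(measurable_restrict _ _ _) => //; rewrite setIidr//.
  by apply/measurable_EFinP; exact: measurable_funS mf.
have [|||||_ _] := dominated_convergence (mu := lebesgue_measure)
    (g := abse \o (EFin \o f)) _ mfItr (f := EFin \o f).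
- by [].
- exact/measurable_EFinP.
(* For fixed [t] the truncations are constant once [t] lies in [Itr m], since the intervals
   increase. *)
- apply/aeW => t t0; apply: cvg_near_cst.
  move: t0; rewrite -bigcup_Itr => -[m _ mt].
  exists m => // n /= mn; rewrite patchE mem_set//.
  by have := nondecreasing_Itr mn; rewrite subsetEset; exact.
- exact: integrable_abse.
- apply/aeW => t n t0; rewrite patchE; case: ifPn => // _.
  by rewrite abse0 abse_ge0.
have -> : [sequence \int[mu]_(t in `]0%R, +oo[) ((EFin \o f) \_ (Itr n)) t]_n%E =
   (fun n => (F n.+2%:R - F n.+2%:R^-1)%:E).
  apply/funext => n /=; rewrite -(Itr_FTC n dF cf).
  by rewrite -integral_mkcondr setIidr.
move=> /cvg_lim H.
rewrite /Rintegral -H//.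
have -> : 0 = fine (0%:E) :> R by [].
congr fine; apply/cvg_lim => //; apply: cvg_EFin; first exact: nearW.
by rewrite -[X in _ --> X](subrr 0); apply: cvgB.
Qed.

End integral_0y.

Lemma is_derive_lnD {R : realType} (s y : R) : 0 < s + y ->
  is_derive y 1 (fun y => ln (s + y)) (s + y)^-1.
Proof.
move=> sy0.
have h := @is_derive1_comp _ (@ln R) (fun y => s + y) y _ _ (is_derive1_ln sy0) _.
by apply: is_derive_eq; rewrite add0r !mulr1.
Qed.

(** * Integrability of Gamma-type integrands and Hoelder's inequality *)

Section integral_convexity.
Context {R : realType}.
Implicit Types (f g h : R -> R) (a b t u v x y z : R).
Local Notation mu := (@lebesgue_measure R).

(** Comparison with an explicit derivative: [F t] is [(t / (1 + t))^z], which is bounded by 1, and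
    its derivative [f t] is [z t^(z-1) / (1 + t)^(z+1)]. The factor [(1 + t)^(z+1) exp(-ct)] that
    remains is bounded. *)
Lemma integrable_powR_expR z c : 0 < z -> 0 < c ->
  mu.-integrable `]0, +oo[ (EFin \o (fun t => t `^ (z - 1) * expR (- (c * t)))).
Proof.
move=> z0 c0.
pose F t := expR (z * (ln t - ln (1 + t))).
pose f t := z * (t^-1 - (1 + t)^-1) * F t.
have dF t : 0 < t -> is_derive t 1 F (f t).
  move=> t0.
  have d1 := is_derive1_ln t0.
  have d2 := is_derive_lnD (addr_gt0 ltr01 t0).
  apply: is_derive_eq.
  by rewrite /f /F/= /GRing.scale/= mulrC.
have Fc t : 0 < t -> {for t, continuous F}.
  move=> t0; apply: differentiable_continuous.
  by apply/derivable1_diffP; have [] := dF t t0.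
have fc t : 0 < t -> {for t, continuous f}.
  move=> t0; apply: cvgM; last exact: Fc.
  apply: cvgM; first exact: cvg_cst.
  apply: cvgB; apply: cvgV; rewrite ?gt_eqF//; last first.
    by apply: cvgD; [exact: cvg_cst|exact: cvg_id].
  by rewrite addr_gt0.
have F01 t : 0 < t -> 0 <= F t <= 1.
  move=> t0; rewrite /F expR_ge0/= -[leRHS]expR0 ler_expR.
  rewrite pmulr_rle0// subr_le0 ler_ln ?posrE ?addr_gt0//; lra.
have f0 t : 0 < t -> 0 <= f t.
  move=> t0; rewrite /f mulr_ge0 ?expR_ge0// mulr_ge0 ?(ltW z0)//.
  rewrite subr_ge0 lef_pV2 ?posrE ?addr_gt0//; lra.
have fi := bounded_antiderivative_integrable_0y dF fc f0 F01.
pose m := 1 + z.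
(* The exponential is the value of [u^m exp(c - c u)] at its maximum point [u = m / c], where [u]
   stands for [1 + t]; [z^-1] cancels the factor [z] of [f]. *)
pose K := z^-1 * expR (c - m - m * ln (c / m)).
have m0 : 0 < m by rewrite /m; lra.
apply: (le_integrable _ _ _ (integrableZl _ K fi)) => //.
  apply/measurable_EFinP; apply: measurable_funM.
    exact: measurable_funTS (measurable_powR _).
  apply: (measurableT_comp (@measurable_expR R)).
  by apply: measurable_funTS; apply: continuous_measurable_fun => x;
    apply: cvgN; apply: cvgM; [exact: cvg_cst|exact: cvg_id].
move=> t; rewrite /= in_itv/= andbT => t0.
have t1 : 0 < 1 + t by rewrite addr_gt0.
rewrite lee_fin !ger0_norm; last 2 first.
- by apply: mulr_ge0 (f0 t t0); rewrite mulr_ge0 ?expR_ge0 ?invr_ge0 ?ltW.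
- by rewrite mulr_ge0 ?powR_ge0 ?expR_ge0.
have E1 : t^-1 - (1 + t)^-1 = expR (- ln t - ln (1 + t)).
  rewrite expRD !expRN !lnK ?posrE//; field; rewrite !gt_eqF//.
have cancelz (u v w : R) : z^-1 * u * (z * v * w) = u * v * w.
  by field; rewrite gt_eqF.
rewrite /powR gt_eqF// /K /f /F E1 cancelz -!expRD ler_expR.
(* The bound is [ln y <= y - 1] at [y = (1 + t) c / m], multiplied by [m]. *)
have : ln ((1 + t) * (c / m)) <= (1 + t) * (c / m) - 1.
  have y0 : 0 < (1 + t) * (c / m) by rewrite mulr_gt0 ?divr_gt0.
  by rewrite -[X in ln X](subrKC 1) le_ln1Dx//; lra.
rewrite lnM ?posrE ?divr_gt0// -(ler_pM2l m0) !mulrBr mulrDr mulr1.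
rewrite [m * ((1 + t) * _)](_ : _ = (1 + t) * c); last by field; rewrite gt_eqF.
rewrite /m; lra.
Qed.

(** A zero integral would force [f = 0] almost everywhere; as [f] never vanishes, the half-line
    would lie in a null set, although its measure is infinite. *)
Lemma Rintegral_gt0_0y f : mu.-integrable `]0, +oo[ (EFin \o f) ->
  (forall t, 0 < t -> 0 < f t) -> 0 < \int[mu]_(t in `]0, +oo[) f t.
Proof.
move=> fi f0; rewrite lt_neqAle; apply/andP; split; last first.
  by apply: Rintegral_ge0 => t; rewrite /= in_itv/= andbT => /f0/ltW.
apply/eqP => /esym int0.
have mD : measurable (`]0, +oo[ : set (measurableTypeR R)) by [].
have /integrableP[mf _] := fi.
have : (\int[mu]_(t in `]0%R, +oo[) `|(EFin \o f) t| = 0)%E.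
  transitivity ((\int[mu]_(t in `]0, +oo[) f t)%:E); last by rewrite int0.
  rewrite fineK; last exact: integrable_fin_num.
  apply: eq_integral => t; rewrite inE/= in_itv/= andbT => t0.
  by rewrite ger0_norm// ltW// f0.
move=> /(ae_eq_integral_abs mu mD mf).
move=> [N [mN N0 DN]].
have /(le_measure mu) : `]0, +oo[ `<=` N.
  move=> t tD; apply: DN => /= /(_ tD) [] ft0.
  by move: tD; rewrite /= in_itv/= andbT => /f0; rewrite ft0 ltxx.
rewrite !inE => /(_ mD mN).
have muD : mu `]0, +oo[ = +oo%E by rewrite lebesgue_measure_itv/= ltry.
move=> DleN; have : (mu `]0%R, +oo[ <= mu N)%E := DleN.
by rewrite muD N0.
Qed.

(** The tangent to [expR] at the mean [m] lies below the graph; its values at [x] and [y], averaged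
    with weights [l] and [1 - l], give [expR m]. *)
Lemma expR_le_conv (l x y : R) : 0 <= l <= 1 ->
  expR (l * x + (1 - l) * y) <= l * expR x + (1 - l) * expR y.
Proof.
move=> /andP[l0 l1]; set m := l * x + (1 - l) * y.
have tangent u : expR m * (1 + (u - m)) <= expR u.
  by rewrite -[X in _ <= expR X](subrKC m) [leRHS]expRD ler_pM2l ?expR_gt0// expR_ge1Dx.
have l1' : 0 <= 1 - l by lra.
apply: le_trans (lerD (ler_wpM2l l0 (tangent x)) (ler_wpM2l l1' (tangent y))).
rewrite le_eqVlt; apply/orP; left; apply/eqP; rewrite /m; ring.
Qed.

(* Hoelder's inequality in logarithmic form: after normalizing [f] and [g] to
   have integral 1, it is the convexity of [expR] integrated pointwise. *)
Lemma ln_Rintegral_conv (l : R) f g h : 0 <= l <= 1 ->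
  (forall t, 0 < t -> [/\ 0 < f t, 0 < g t & 0 < h t]) ->
  (forall t, 0 < t -> ln (h t) <= l * ln (f t) + (1 - l) * ln (g t)) ->
  mu.-integrable `]0, +oo[ (EFin \o f) ->
  mu.-integrable `]0, +oo[ (EFin \o g) ->
  mu.-integrable `]0, +oo[ (EFin \o h) ->
  ln (\int[mu]_(t in `]0, +oo[) h t) <=
    l * ln (\int[mu]_(t in `]0, +oo[) f t) +
    (1 - l) * ln (\int[mu]_(t in `]0, +oo[) g t).
Proof.
move=> l01 fgh0 hle fi gi hi.
have F0 : 0 < \int[mu]_(t in `]0, +oo[) f t.
  by apply: Rintegral_gt0_0y => // t /fgh0[].
have G0 : 0 < \int[mu]_(t in `]0, +oo[) g t.
  by apply: Rintegral_gt0_0y => // t /fgh0[].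
have H0 : 0 < \int[mu]_(t in `]0, +oo[) h t.
  by apply: Rintegral_gt0_0y => // t /fgh0[].
move: F0 G0 H0; set F := (\int[mu]_(t in `]0, +oo[) f t); set G := (\int[mu]_(t in `]0, +oo[) g t).
set H := (\int[mu]_(t in `]0, +oo[) h t) => F0 G0 H0.
set c := l * ln F + (1 - l) * ln G.
rewrite -ler_expR lnK ?posrE//.
(* These weights satisfy [u * F + v * G = expR c], so integrating the pointwise bound [hfg] yields
   [H <= expR c]. *)
pose u := expR c * l / F; pose v := expR c * (1 - l) / G.
have hfg t : (`]0, +oo[%classic : set R) t -> h t <= u * f t + v * g t.
  rewrite /= in_itv/= andbT => t0; have [ft gt ht] := fgh0 _ t0.
  have -> : u * f t + v * g t =
      expR c * (l * expR (ln (f t) - ln F) + (1 - l) * expR (ln (g t) - ln G)).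
    rewrite !expRB !lnK ?posrE// /u /v; field; rewrite !gt_eqF//.
  apply: le_trans (ler_wpM2l (expR_ge0 _) (expR_le_conv _ _ l01)).
  rewrite -expRD -[h t]lnK ?posrE// ler_expR (le_trans (hle t t0))// /c.
  rewrite le_eqVlt; apply/orP; left; apply/eqP; ring.
have ui := integrableZl _ u fi; have vi := integrableZl _ v gi.
have uvi : mu.-integrable `]0, +oo[ (EFin \o (fun t => u * f t + v * g t)).
  by apply: (integrableD _ (ui _) (vi _)).
apply: le_trans (le_Rintegral _ hi uvi hfg) _ => //.
rewrite RintegralD//; last 2 first.
- exact: ui.
- exact: vi.
rewrite !RintegralZl// -/F -/G /u /v.
by rewrite le_eqVlt; apply/orP; left; apply/eqP; field; rewrite !gt_eqF.
Qed.

End integral_convexity.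

(** * The Gamma function *)

Section Gamma_theory.
Context {R : realType}.
Implicit Types (t u v w x y z : R).
Local Notation mu := (@lebesgue_measure R).

Lemma integrable_Gamma z : 0 < z ->
  mu.-integrable `]0, +oo[ (EFin \o (fun t => t `^ (z - 1) * expR (- t))).
Proof.
move=> z0; apply: eq_integrable (integrable_powR_expR z0 ltr01) => // t _.
by rewrite /= mul1r.
Qed.

Lemma Gamma_gt0 z : 0 < z -> 0 < Gamma z.
Proof.
move=> z0; apply: Rintegral_gt0_0y; first exact: integrable_Gamma.
by move=> t t0; rewrite mulr_gt0 ?powR_gt0 ?expR_gt0.
Qed.

Lemma cvg_harmonic2 : (n.+2%:R^-1 : R) @[n --> \oo] --> (0 : R).
Proof. by have := @cvg_harmonic R; rewrite -cvg_shiftS. Qed.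

(** Integration by parts: the integrand of [z * Gamma z - Gamma (z + 1)] is the derivative of
    [t^z exp(-t)], which vanishes at both ends of the half-line. *)
Lemma GammaS z : 0 < z -> Gamma (z + 1) = z * Gamma z.
Proof.
move=> z0; apply/esym/eqP; rewrite -subr_eq0; apply/eqP.
have i1 := integrable_Gamma z0.
have i2 : mu.-integrable `]0, +oo[ (EFin \o (fun t => t `^ (z + 1 - 1) * expR (- t))).
  by apply: integrable_Gamma; rewrite addr_gt0.
rewrite /Gamma -RintegralZl// -RintegralB//; last first.
  exact: (integrableZl _ z i1).
apply: (@Rintegral_derive_eq0 _ (fun t => t `^ z * expR (- t))).
- move=> t t0; have h := is_derive1_powR z t0.
  apply: is_derive_eq.
  by rewrite /GRing.scale/= addrK; ring.
- move=> t t0.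
  have cE : {for t, continuous (fun t : R => expR (- t))}.
    apply: continuous_comp; last exact: continuous_expR.
    by apply: cvgN; exact: cvg_id.
  have cP y : {for t, continuous (fun t : R => t `^ y)}.
    apply: differentiable_continuous; apply/derivable1_diffP.
    by have [] := is_derive1_powR y t0.
  apply: cvgB; last exact: cvgM (cP _) cE.
  by apply: cvgM; [exact: cvg_cst|exact: cvgM (cP _) cE].
- apply: (integrableB _ (integrableZl _ z i1) i2) => //.
(* At infinity: [t^m exp(-t)] is largest at [t = m], hence [t^z exp(-t)] is at most a constant times
   [1 / t]. *)
- pose m := z + 1; have m0 : 0 < m by rewrite /m addr_gt0.
  have le_inv t : 0 < t -> t `^ z * expR (- t) <= expR (m * ln m - m) * t^-1.
    move=> t0; rewrite /powR gt_eqF// -[t in leRHS]lnK ?posrE// -expRN -!expRD.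
    rewrite ler_expR.
    have : ln (t / m) <= t / m - 1.
      have y0 : 0 < t / m by rewrite divr_gt0.
      by rewrite -[X in ln X](subrKC 1) le_ln1Dx//; lra.
    rewrite ln_div ?posrE// -(ler_pM2l m0) !mulrBr mulr1 mulrCA divff ?gt_eqF//.
    by rewrite mulr1 /m; lra.
  apply: (@squeeze_cvgr _ _ _ _ (fun=> 0) (fun n => expR (m * ln m - m) * n.+2%:R^-1)).
  + apply: nearW => n; rewrite le_inv// andbT.
    by rewrite mulr_ge0 ?powR_ge0 ?expR_ge0.
  + exact: cvg_cst.
  + rewrite -[X in _ --> X](mulr0 (expR (m * ln m - m))).
    by apply: cvgM; [exact: cvg_cst|exact: cvg_harmonic2].
- apply: (@squeeze_cvgr _ _ _ _ (fun=> 0) (fun n => n.+2%:R^-1 `^ z)).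
  + apply: nearW => n; rewrite mulr_ge0 ?powR_ge0 ?expR_ge0//=.
    by rewrite ler_piMr ?powR_ge0// -expR0 ler_expR oppr_le0 invr_ge0.
  + exact: cvg_cst.
  + have /cvg_at_rightP := powR_cvg0 z0; apply; split=> [n|].
      by rewrite invr_gt0.
    exact: cvg_harmonic2.
Qed.

Lemma ln_GammaS z : 0 < z -> ln (Gamma (z + 1)) = ln (Gamma z) + ln z.
Proof. by move=> z0; rewrite GammaS// lnM ?posrE ?Gamma_gt0// addrC. Qed.

(** The logarithm of Euler's integrand is affine in the argument of [Gamma], so the pointwise
    hypothesis of [ln_Rintegral_conv] holds with equality. *)
Lemma ln_Gamma_conv (l z w : R) : 0 <= l <= 1 -> 0 < z -> 0 < w ->
  ln (Gamma (l * z + (1 - l) * w)) <= l * ln (Gamma z) + (1 - l) * ln (Gamma w).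
Proof.
move=> l01 z0 w0; have /andP[l0 l1] := l01.
have zw0 : 0 < l * z + (1 - l) * w by nra.
apply: ln_Rintegral_conv; rewrite //; try exact: integrable_Gamma.
- by move=> t t0; rewrite !mulr_gt0 ?powR_gt0 ?expR_gt0.
- move=> t t0; rewrite !lnM ?posrE ?powR_gt0 ?expR_gt0// !ln_powR expRK.
  rewrite le_eqVlt; apply/orP; left; apply/eqP; ring.
Qed.

(** Log-convexity at [z - 1 < z < z + y]: the slope over the last interval is at least the increment
    [ln (z - 1)] over the first, which has length 1. *)
Lemma ln_GammaD_ge z y : 1 < z -> 0 < y ->
  y * ln (z - 1) <= ln (Gamma (z + y)) - ln (Gamma z).
Proof.
move=> z1 y0; have y1 : 0 < 1 + y by lra.
have l01 : 0 <= y / (1 + y) <= 1.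
  by rewrite divr_ge0 ?(ltW y0) ?(ltW y1)//= ler_pdivrMr// mul1r; lra.
have z0 : 0 < z - 1 by lra.
have zy0 : 0 < z + y by lra.
have := ln_Gamma_conv l01 z0 zy0.
have -> : y / (1 + y) * (z - 1) + (1 - y / (1 + y)) * (z + y) = z.
  by field; rewrite gt_eqF.
have clear u v : (1 + y) * (y / (1 + y) * u + (1 - y / (1 + y)) * v) = y * u + v.
  by field; rewrite gt_eqF.
rewrite -(ler_pM2l y1) clear.
have := ln_GammaS z0; rewrite subrK => ->.
move: (ln (Gamma (z - 1))) (ln (Gamma (z + y))) (ln (z - 1)) => g1 g2 r; lra.
Qed.

(** The companion bound, from log-convexity at [z < z + y < z + y + 1]; the increment over the last
    interval is [ln (z + y)]. *)
Lemma ln_GammaD_le z y : 0 < z -> 0 < y ->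
  ln (Gamma (z + y)) - ln (Gamma z) <= y * ln (z + y).
Proof.
move=> z0 y0; have y1 : 0 < 1 + y by lra.
have l01 : 0 <= (1 + y)^-1 <= 1.
  by rewrite invr_ge0 (ltW y1)/= invf_le1//; lra.
have zy0 : 0 < z + y by lra.
have zy1 : 0 < z + y + 1 by lra.
have := ln_Gamma_conv l01 z0 zy1.
have -> : (1 + y)^-1 * z + (1 - (1 + y)^-1) * (z + y + 1) = z + y.
  by field; rewrite gt_eqF.
have clear u v : (1 + y) * ((1 + y)^-1 * u + (1 - (1 + y)^-1) * v) = u + y * v.
  by field; rewrite gt_eqF.
rewrite -(ler_pM2l y1) clear.
rewrite (ln_GammaS zy0).
move: (ln (Gamma z)) (ln (Gamma (z + y))) (ln (z + y)) => g1 g2 r; lra.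
Qed.

(** The logarithm of Gauss' approximant [Gamma(n) n^y / (y (y + 1) ... (y + n - 1))]. *)
Definition ln_Gauss (n : nat) y : R :=
  ln (Gamma n%:R) + y * ln n%:R - \sum_(k < n) ln (y + k%:R).

Lemma ln_GammaDn y n : 0 < y ->
  ln (Gamma (y + n%:R)) = ln (Gamma y) + \sum_(k < n) ln (y + k%:R).
Proof.
move=> y0; elim: n => [|n IH]; first by rewrite big_ord0 !addr0.
rewrite big_ord_recr/= addrA -IH -natr1 addrA ln_GammaS//.
by rewrite (lt_le_trans y0)// lerDl.
Qed.

(** The increment of [ln Gamma] from [n] to [n + y] lies between [y ln (n - 1)] and [y ln (n + y)].
    Hence the error lies between [- y ln (1 + y / n)] and [- y ln (1 - 1 / n)], and both tend to
    0. *)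
Lemma cvg_ln_Gauss y : 0 < y -> ln_Gauss n y @[n --> \oo] --> ln (Gamma y).
Proof.
move=> y0.
(* Two terms are dropped because the lower bound [ln_GammaD_ge] requires [n > 1]. *)
rewrite -cvg_shiftS -cvg_shiftS/=.
have lnE n (x : R) : 0 < n.+2%:R + x -> ln (n.+2%:R + x) = ln n.+2%:R + ln (1 + x * n.+2%:R^-1).
  move=> x0; have x1 : 0 < 1 + x * n.+2%:R^-1.
    by rewrite -(pmulr_rgt0 _ (ltr0Sn R n.+1)) mulrDr mulr1 mulrCA divff// mulr1.
  rewrite -lnM ?posrE//; congr ln.
  by field.
have cvg_ln1 (c : R) :
    ln (Gamma y) - y * ln (1 + c * n.+2%:R^-1) @[n --> \oo] --> ln (Gamma y).
  rewrite -[X in _ --> X]subr0 -[X in _ --> _ - X](mulr0 y).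
  apply: cvgB; first exact: cvg_cst.
  apply: cvgM; first exact: cvg_cst.
  rewrite -ln1; apply: continuous_cvg; first exact: continuous_ln.
  rewrite -[X in _ --> X]addr0 -[X in _ --> _ + X](mulr0 c).
  apply: cvgD; first exact: cvg_cst.
  by apply: cvgM; [exact: cvg_cst|exact: cvg_harmonic2].
apply: (@squeeze_cvgr _ _ _ _ (fun n => ln (Gamma y) - y * ln (1 + y * n.+2%:R^-1))
   (fun n => ln (Gamma y) - y * ln (1 + (-1) * n.+2%:R^-1))).
- apply: nearW => n; rewrite /ln_Gauss.
  have n1 : 1 < n.+2%:R :> R by rewrite ltr1n.
  have n0 : 0 < n.+2%:R :> R by [].
  have ny0 : 0 < n.+2%:R + y by rewrite addr_gt0.
  have nB0 : 0 < n.+2%:R + (-1) :> R by lra.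
  have := ln_GammaD_ge n1 y0; have := ln_GammaD_le n0 y0.
  rewrite (lnE n _ ny0) (lnE n _ nB0) [n.+2%:R + y]addrC (ln_GammaDn n.+2 y0).
  move: (ln (Gamma y)) (ln (Gamma n.+2%:R)) (\sum_(k < _) _) (ln n.+2%:R).
  move: (ln (1 + y * _)) (ln (1 + -1 * _)) => r1 r2 g gn S r.
  by rewrite !mulrDr => h1 h2; apply/andP; split; lra.
- exact: cvg_ln1 y.
- exact: cvg_ln1 (-1).
Qed.

(** A pointwise limit of the functions [ln_Gauss n], which are finite combinations of logarithms. *)
Lemma measurable_ln_Gamma (d : measure_display) (T : measurableType d)
    (D : set T) (f : T -> R) : (forall s, D s -> 0 < f s) ->
  measurable_fun D f -> measurable_fun D (fun s => ln (Gamma (f s))).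
Proof.
move=> f0 mf; apply: (@measurable_fun_cvg _ _ _ _ (fun n s => ln_Gauss n (f s))).
  move=> n; apply: measurable_funB.
    by apply: measurable_funD; [exact: measurable_cst|exact: measurable_funM].
  apply: measurable_sum => k.
  apply: (measurableT_comp (@measurable_ln R)).
  by apply: measurable_funD.
by move=> s /f0; exact: cvg_ln_Gauss.
Qed.

End Gamma_theory.

(** * Weak majorization and ratios of Gamma functions *)

(** By the mean value theorem [h u - h v] is [d c * (u - v)] with [c] between [u] and [v], and [d]
    is monotone. *)
Lemma convex_tangent {R : realType} (h d : R -> R) (u v : R) :
  (forall y : R, 0 < y -> is_derive y 1 h (d y)) ->
  (forall y z : R, 0 < y -> y <= z -> d y <= d z) ->
  0 < u -> 0 < v -> d v * (u - v) <= h u - h v.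
Proof.
move=> dh dnd u0 v0.
have MVTh (x y : R) : 0 < x -> x < y ->
    exists2 c, c \in `]x, y[%R & h y - h x = d c * (y - x).
  move=> x0 xy; apply: MVT => //.
    by move=> z; rewrite in_itv/= => /andP[xz _]; apply: dh; exact: lt_trans xz.
  apply: derivable_within_continuous => z; rewrite in_itv/= => /andP[xz _].
  by have [] := dh z (lt_le_trans x0 xz).
have [uv|vu|->] := ltgtP u v; last by rewrite !subrr mulr0.
- have [c /[!in_itv]/= /andP[uc cv] hE] := MVTh _ _ u0 uv.
  have := dnd c v (lt_trans u0 uc) (ltW cv); nra.
- have [c /[!in_itv]/= /andP[vc cu] ->] := MVTh _ _ v0 vu.
  by rewrite ler_wpM2r ?subr_ge0 ?(ltW vu)// dnd// ltW.
Qed.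

(** Abel summation as an induction: the last weight times the partial sum of [d] stays below the
    weighted sum, because lowering the weight of a nonnegative partial sum only decreases it. *)
Lemma sum_mul_nonincreasing_ge0 {R : realDomainType} (p : nat) (w d : nat -> R) :
  (forall i, (i < p)%N -> 0 <= w i) ->
  (forall i, (i.+1 < p)%N -> w i.+1 <= w i) ->
  (forall k, (k <= p)%N -> 0 <= \sum_(i < k) d i) ->
  0 <= \sum_(i < p) w i * d i.
Proof.
case: p => [|p] w0 wd S0; first by rewrite big_ord0.
suff H k : (k < p.+1)%N -> w k * (\sum_(i < k.+1) d i) <= \sum_(i < k.+1) w i * d i.
  by apply: le_trans (H p (ltnSn p)); rewrite mulr_ge0 ?w0 ?S0.
elim: k => [|k IH] kp; first by rewrite !big_ord1.
rewrite big_ord_recr/= [leRHS]big_ord_recr/= mulrDr lerD2r.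
apply: le_trans (IH (ltnW kp)).
by rewrite ler_wpM2r ?wd// S0// ltnW.
Qed.

(* The hypothesis on partial sums is weak supermajorization of [b] by [a], so
   convex nonincreasing functions have a larger sum over [a]. *)
Lemma weak_majorization {R : realType} (p : nat) (a b : 'I_p -> R) (h d : R -> R) :
  (forall i, 0 < a i) -> (forall i, 0 < b i) ->
  (forall i j : 'I_p, (i <= j)%N -> b i <= b j) ->
  (forall k : nat, (1 <= k <= p)%N ->
     0 <= \sum_(j < p | (j < k)%N) b j - \sum_(j < p | (j < k)%N) a j) ->
  (forall y : R, 0 < y -> is_derive y 1 h (d y)) ->
  (forall y : R, 0 < y -> d y <= 0) ->
  (forall y z : R, 0 < y -> y <= z -> d y <= d z) ->
  \sum_i h (b i) <= \sum_i h (a i).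
Proof.
case: p a b => [|p] a b a0 b0 bnd hab dh d0 dnd; first by rewrite !big_ord0.
rewrite -subr_ge0 -sumrB.
(* The tangent inequality at each [b i] reduces the claim to a weighted sum of [b i - a i]. The
   weights [- d (b i)] are nonnegative, and nonincreasing since [b] is sorted and [d] is
   nondecreasing. *)
apply: (@le_trans _ _ (\sum_i (- d (b i)) * (b i - a i))); last first.
  apply: ler_sum => i _; have := convex_tangent dh dnd (a0 i) (b0 i).
  by rewrite mulNr -mulrN opprB.
pose e (f : 'I_p.+1 -> R) k := f (inord k).
have -> : \sum_i - d (b i) * (b i - a i) =
          \sum_(i < p.+1) (fun k => - d (e b k)) i * (e b i - e a i).
  by apply: eq_bigr => i _; rewrite /e inord_val.
apply: (@sum_mul_nonincreasing_ge0 _ _ (fun k => - d (e b k)) (fun k => e b k - e a k)).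
- by move=> i _; rewrite oppr_ge0 d0// b0.
- by move=> i ip; rewrite lerN2 dnd ?b0// bnd// !inordK// ltnW.
- case=> [|k] kp; first by rewrite big_ord0.
  rewrite sumrB !(big_ord_widen p.+1 (e _))//.
  have := hab k.+1 kp; congr (0 <= _ - _); apply: eq_bigr => i _;
    by rewrite /e inord_val.
Qed.

(** * Monotonicity and convexity of the logarithm of the Gamma ratio *)

Section Gamma_ratio.
Context {R : realType} (p : nat) (a b : 'I_p -> R).
Hypotheses (a_gt0 : forall i, 0 < a i) (b_gt0 : forall i, 0 < b i).
Hypothesis b_nd : forall i j : 'I_p, (i <= j)%N -> b i <= b j.
Hypothesis hab : forall k : nat, (1 <= k <= p)%N ->
  0 <= \sum_(j < p | (j < k)%N) b j - \sum_(j < p | (j < k)%N) a j.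

Let maj h d := weak_majorization (h := h) (d := d) a_gt0 b_gt0 b_nd hab.

(** By the functional equation this is the increment of the logarithmic Gamma ratio from [s] to
    [s + 1], for [s >= 0]. *)
Let ln_ratio (s : R) := \sum_i (ln (s + a i) - ln (s + b i)).

Let ln_ratio_nd (s t : R) : 0 <= s -> s <= t -> ln_ratio s <= ln_ratio t.
Proof.
move=> s0 st; have t0 := le_trans s0 st.
have := @maj (fun y => ln (t + y) - ln (s + y)) (fun y => (t + y)^-1 - (s + y)^-1).
(* In this form the derivative is visibly nonpositive and nondecreasing in [y]. *)
have E (y : R) : 0 < y ->
    (t + y)^-1 - (s + y)^-1 = - ((t - s) * ((t + y)^-1 * (s + y)^-1)).
  by move=> y0; field; rewrite !gt_eqF//; lra.
rewrite /ln_ratio !sumrB => H; suff : \sum_i ln (t + b i) - \sum_i ln (s + b i) <=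
    \sum_i ln (t + a i) - \sum_i ln (s + a i) by lra.
apply: H => [y y0|y y0|y z y0 yz].
- have h1 := is_derive_lnD (ltr_wpDl s0 y0); have h2 := is_derive_lnD (ltr_wpDl t0 y0).
  exact: is_deriveB.
- rewrite subr_le0 lef_pV2 ?posrE; lra.
- have z0 := lt_le_trans y0 yz; rewrite !E// lerN2 ler_wpM2l ?subr_ge0//.
  by rewrite ler_pM ?invr_ge0 ?lef_pV2 ?posrE; lra.
Qed.

Let ln_ratio_conc (l s t : R) : 0 <= l <= 1 -> 0 <= s -> 0 <= t ->
  l * ln_ratio s + (1 - l) * ln_ratio t <= ln_ratio (l * s + (1 - l) * t).
Proof.
move=> /andP[l0 l1] s0 t0; set w := l * s + (1 - l) * t.
have w0 : 0 <= w by rewrite /w; nra.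
pose d (y : R) := (w + y)^-1 - (l * (s + y)^-1 + (1 - l) * (t + y)^-1).
have := @maj (fun y => ln (w + y) - (l * ln (s + y) + (1 - l) * ln (t + y))) d.
(* The Jensen gap of the reciprocal in closed form; sign and monotonicity in [y] can be read off
   from the factors. *)
have E (y : R) : 0 < y ->
    d y = - (l * (1 - l) * (s - t) ^+ 2 * ((w + y)^-1 * ((s + y)^-1 * (t + y)^-1))).
  move=> y0; rewrite /d /w; field.
  by rewrite !gt_eqF//; nra.
have c0 : 0 <= l * (1 - l) * (s - t) ^+ 2 by rewrite mulr_ge0 ?sqr_ge0//; nra.
rewrite /ln_ratio !sumrB !big_split/= -!mulr_sumr => H.
suff : \sum_i ln (w + b i) -
      (l * (\sum_i ln (s + b i)) + (1 - l) * (\sum_i ln (t + b i))) <=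
    \sum_i ln (w + a i) -
      (l * (\sum_i ln (s + a i)) + (1 - l) * (\sum_i ln (t + a i))) by lra.
apply: H => [y y0|y y0|y z y0 yz].
- have h1 := is_derive_lnD (ltr_wpDl s0 y0); have h2 := is_derive_lnD (ltr_wpDl t0 y0).
  have h3 := is_derive_lnD (ltr_wpDl w0 y0).
  apply: is_derive_eq; rewrite /d /GRing.scale/=; ring.
- by rewrite E// oppr_le0 mulr_ge0// !mulr_ge0 ?invr_ge0//; lra.
- have z0 := lt_le_trans y0 yz; rewrite !E// lerN2 ler_wpM2l//.
  by rewrite !ler_pM ?mulr_ge0 ?invr_ge0 ?lef_pV2 ?posrE; lra.
Qed.

Definition ln_Gamma_ratio (s : R) :=
  \sum_i (ln (Gamma (s + a i)) - ln (Gamma (s + b i))).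

(** The difference of the Gauss approximants, summed over [i]. The terms [ln (Gamma n)] and [s ln n]
    cancel, so [s] enters only through [ln_ratio]. *)
Let approx n s := (\sum_i (a i - b i)) * ln n%:R - \sum_(k < n) ln_ratio (s + k%:R).

Let cvg_approx s : 0 <= s -> approx n s @[n --> \oo] --> ln_Gamma_ratio s.
Proof.
move=> s0.
have -> : approx ^~ s = (fun n => \sum_i (ln_Gauss n (s + a i) - ln_Gauss n (s + b i))).
  apply/funext => n; rewrite /approx /ln_ratio exchange_big/= mulr_suml -sumrB.
  apply: eq_bigr => i _; rewrite /ln_Gauss sumrB.
  have E (c : R) : \sum_(k < n) ln (s + k%:R + c) = \sum_(k < n) ln (s + c + k%:R).
    by apply: eq_bigr => k _; rewrite addrAC.
  rewrite !E; ring.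
apply: cvg_big => [|i _]; first exact: add_continuous.
by apply: cvgB; apply: cvg_ln_Gauss; rewrite ltr_wpDl.
Qed.

Lemma ln_Gamma_ratio_nonincreasing s t : 0 <= s -> s <= t ->
  ln_Gamma_ratio t <= ln_Gamma_ratio s.
Proof.
move=> s0 st; apply: (ler_cvg_to (cvg_approx (le_trans s0 st)) (cvg_approx s0)).
apply: nearW => n; rewrite /approx lerD2l lerN2; apply: ler_sum => k _.
by rewrite ln_ratio_nd ?lerD2r// addr_ge0.
Qed.

(** Each [approx n] is a constant minus a sum of concave functions of [s], hence convex, and the
    inequality passes to the limit. *)
Lemma ln_Gamma_ratio_conv (l s t : R) : 0 <= l <= 1 -> 0 <= s -> 0 <= t ->
  ln_Gamma_ratio (l * s + (1 - l) * t) <=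
    l * ln_Gamma_ratio s + (1 - l) * ln_Gamma_ratio t.
Proof.
move=> l01 s0 t0; have /andP[l0 l1] := l01.
have w0 : 0 <= l * s + (1 - l) * t by nra.
apply: (ler_cvg_to (cvg_approx w0) (g := fun n => l * approx n s + (1 - l) * approx n t)).
  by apply: cvgD; apply: cvgM; (exact: cvg_cst || exact: cvg_approx).
apply: nearW => n; rewrite /approx.
have : \sum_(k < n) (l * ln_ratio (s + k%:R) + (1 - l) * ln_ratio (t + k%:R)) <=
    \sum_(k < n) ln_ratio (l * s + (1 - l) * t + k%:R).
  apply: ler_sum => k _.
  have -> : l * s + (1 - l) * t + k%:R = l * (s + k%:R) + (1 - l) * (t + k%:R).
    by ring.
  by apply: ln_ratio_conc; rewrite ?addr_ge0.
rewrite big_split/= -!mulr_sumr; lra.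
Qed.

End Gamma_ratio.

(** * The Volterra function *)

Section volterra_integrand.
Context {R : realType} (p : nat) (alpha beta x : R) (a b : 'I_p -> R).
Hypotheses (beta_gtN1 : -1 < beta) (x01 : 0 < x < 1).
Hypotheses (a_gt0 : forall i, 0 < a i) (b_gt0 : forall i, 0 < b i).
Hypothesis b_nd : forall i j : 'I_p, (i <= j)%N -> b i <= b j.
Hypothesis hab : forall k : nat, (1 <= k <= p)%N ->
  0 <= \sum_(j < p | (j < k)%N) b j - \sum_(j < p | (j < k)%N) a j.
Local Notation mu := (@lebesgue_measure R).

Definition volterra_integrand (A t : R) : R :=
  (\prod_(i < p) (Gamma (A * t + a i) / Gamma (A * t + b i))) *
  (x `^ (t + alpha) * t `^ beta / Gamma (beta + 1)).

Let prod_Gamma_ratio (s : R) : 0 <= s ->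
  \prod_(i < p) (Gamma (s + a i) / Gamma (s + b i)) = expR (ln_Gamma_ratio a b s).
Proof.
move=> s0; rewrite expR_sum; apply: eq_bigr => i _.
have divE (u v : R) : 0 < u -> 0 < v -> u / v = expR (ln u - ln v).
  by move=> u0 v0; rewrite expRB !lnK.
by apply: divE; apply: Gamma_gt0; exact: ltr_wpDl.
Qed.

Let weight_gt0 (t : R) : 0 < t ->
  0 < x `^ (t + alpha) * t `^ beta / Gamma (beta + 1).
Proof.
have /andP[x0 _] := x01; have z0 : 0 < beta + 1 by move: beta_gtN1; lra.
by move=> t0; rewrite divr_gt0 ?mulr_gt0 ?powR_gt0 ?Gamma_gt0.
Qed.

Lemma volterra_integrand_gt0 (A t : R) : 0 < A -> 0 < t -> 0 < volterra_integrand A t.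
Proof.
move=> A0 t0; rewrite /volterra_integrand prod_Gamma_ratio ?mulr_ge0 ?ltW//.
by rewrite mulr_gt0 ?expR_gt0 ?weight_gt0.
Qed.

Let ln_volterra_integrandE (A t : R) : 0 < A -> 0 < t ->
  ln (volterra_integrand A t) =
    ln_Gamma_ratio a b (A * t) + ln (x `^ (t + alpha) * t `^ beta / Gamma (beta + 1)).
Proof.
move=> A0 t0; have At0 : 0 <= A * t by rewrite mulr_ge0 ?ltW.
rewrite /volterra_integrand prod_Gamma_ratio//.
by rewrite lnM ?expRK// posrE; [exact: expR_gt0|exact: weight_gt0].
Qed.

(** For fixed [t] the argument [A * t] is linear in [A], and the remaining factor of the integrand
    does not involve [A]. *)
Lemma ln_volterra_integrand_conv (l A B t : R) :
  0 <= l <= 1 -> 0 < A -> 0 < B -> 0 < t ->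
  ln (volterra_integrand (l * A + (1 - l) * B) t) <=
    l * ln (volterra_integrand A t) + (1 - l) * ln (volterra_integrand B t).
Proof.
move=> l01 A0 B0 t0; have /andP[l0 l1] := l01.
have At0 : 0 <= A * t by rewrite mulr_ge0 ?ltW.
have Bt0 : 0 <= B * t by rewrite mulr_ge0 ?ltW.
have C0 : 0 < l * A + (1 - l) * B by nra.
have := ln_Gamma_ratio_conv a_gt0 b_gt0 b_nd hab l01 At0 Bt0.
have -> : l * (A * t) + (1 - l) * (B * t) = (l * A + (1 - l) * B) * t by ring.
have shift (u v w k u' v' w' : R) : u' = u + k -> v' = v + k -> w' = w + k ->
    u <= l * v + (1 - l) * w -> u' <= l * v' + (1 - l) * w'.
  by move=> -> -> ->; lra.
exact: shift (ln_volterra_integrandE C0 t0) (ln_volterra_integrandE A0 t0)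
  (ln_volterra_integrandE B0 t0).
Qed.

(** The Gamma ratio is at most its value at 0, and the remaining factor is a constant times
    [t^beta exp(-ct)] with [c = - ln x], positive because [x < 1]. *)
Lemma integrable_volterra_integrand (A : R) : 0 < A ->
  mu.-integrable `]0, +oo[ (EFin \o volterra_integrand A).
Proof.
move=> A0; have /andP[x0 x1] := x01.
have z0 : 0 < beta + 1 by move: beta_gtN1; lra.
have c0 : 0 < - ln x by rewrite oppr_gt0 ln_lt0// x0.
pose K := x `^ alpha / Gamma (beta + 1).
pose g (t : R) := K * (t `^ (beta + 1 - 1) * expR (- (- ln x * t))).
have mD : measurable (`]0, +oo[ : set (measurableTypeR R)) by [].
have gi : mu.-integrable `]0, +oo[ (EFin \o g).
  exact: (integrableZl _ K (integrable_powR_expR z0 c0)).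
have gE (t : R) : x `^ (t + alpha) * t `^ beta / Gamma (beta + 1) = g t.
  rewrite /g /K addrK powRD ?(gt_eqF x0) ?implybT// [x `^ t]/powR gt_eqF//.
  by rewrite mulNr opprK [ln x * t]mulrC; ring.
have K0 : 0 < K by rewrite divr_gt0 ?powR_gt0 ?Gamma_gt0.
apply: (le_integrable mD _ _ (integrableZl mD (expR (ln_Gamma_ratio a b 0)) gi)).
  apply/measurable_EFinP.
  (* Measurability is proved for the exponential form of the Gamma ratio, which agrees with the
     product on the half-line. *)
  apply: (eq_measurable_fun (fun t => expR (ln_Gamma_ratio a b (A * t)) * g t)).
    move=> t; rewrite inE/= in_itv/= andbT => t0.
    by rewrite /volterra_integrand prod_Gamma_ratio ?gE// mulr_ge0 ?ltW.
  apply: measurable_funM; last first.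
    by apply/measurable_EFinP; have /integrableP[] := gi.
  apply: (measurableT_comp (@measurable_expR R)).
  apply: measurable_sum => i.
  have mA (c : R) : measurable_fun `](0 : R), +oo[ (fun t => A * t + c).
    apply: measurable_funD => //; exact: measurable_funM.
  by apply: measurable_funB; apply: measurable_ln_Gamma => // t;
    rewrite /= in_itv/= andbT => t0; rewrite addr_gt0 ?mulr_gt0.
move=> t; rewrite /= in_itv/= andbT => t0.
have g0 : 0 < g t by rewrite -gE weight_gt0.
rewrite lee_fin (ger0_norm (ltW (volterra_integrand_gt0 A0 t0))).
rewrite ger0_norm; last by rewrite mulr_ge0 ?expR_ge0// ltW.
have At0 : 0 <= A * t by rewrite mulr_ge0 ?ltW.
rewrite /volterra_integrand (prod_Gamma_ratio At0) gE.
apply: ler_wpM2r; first exact: ltW.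
rewrite ler_expR; exact: (ln_Gamma_ratio_nonincreasing a_gt0 b_gt0 b_nd hab).
Qed.

Lemma volterra_gt0 (A : R) : 0 < A -> 0 < volterra a b alpha beta x A.
Proof.
move=> A0; apply: Rintegral_gt0_0y; first exact: integrable_volterra_integrand.
by move=> t; exact: volterra_integrand_gt0.
Qed.

Lemma ln_volterra_conv (l A B : R) : 0 <= l <= 1 -> 0 < A -> 0 < B ->
  ln (volterra a b alpha beta x (l * A + (1 - l) * B)) <=
    l * ln (volterra a b alpha beta x A) +
    (1 - l) * ln (volterra a b alpha beta x B).
Proof.
move=> l01 A0 B0; have /andP[l0 l1] := l01.
have C0 : 0 < l * A + (1 - l) * B by nra.
apply: ln_Rintegral_conv => //; try exact: integrable_volterra_integrand.
- by move=> t t0; split; exact: volterra_integrand_gt0.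
- by move=> t t0; exact: ln_volterra_integrand_conv.
Qed.

End volterra_integrand.

Theorem corollary1 (R : realType) (p : nat) (alpha beta x : R)
    (a b : 'I_p -> R)
    (halpha : -1 < alpha) (hbeta : -1 < beta) (hx : 0 < x < 1)
    (a_gt0 : forall i, 0 < a i)
    (a_nd : forall i j : 'I_p, (i <= j)%N -> a i <= a j)
    (b_gt0 : forall i, 0 < b i)
    (b_nd : forall i j : 'I_p, (i <= j)%N -> b i <= b j)
    (hab : forall k : nat, (1 <= k <= p)%N ->
       0 <= \sum_(j < p | (j < k)%N) b j - \sum_(j < p | (j < k)%N) a j) :
  log_convex `]0, +oo[ (volterra a b alpha beta x) /\
  (forall A : R, 0 < A ->
     0 <= volterra a b alpha beta x A * volterra a b alpha beta x (A + 2)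
          - volterra a b alpha beta x (A + 1) ^+ 2).
Proof.
have W0 A := volterra_gt0 alpha hbeta hx a_gt0 b_gt0 b_nd hab (A := A).
have Wc l A B := ln_volterra_conv alpha hbeta hx a_gt0 b_gt0 b_nd hab
  (l := l) (A := A) (B := B).
split.
  split=> [A|l A B]; first by rewrite /= in_itv/= andbT; exact: W0.
  rewrite !inE/= !in_itv/= !andbT => A0 B0.
  by apply: (Wc l%:num) => //; rewrite ge0 le1.
move=> A A0; have A1 : 0 < A + 1 by lra.
have A2 : 0 < A + 2 by lra.
have half : 0 <= (2^-1 : R) <= 1 by lra.
have := Wc (2^-1) A (A + 2) half A0 A2.
have -> : 2^-1 * A + (1 - 2^-1) * (A + 2) = A + 1 by field.
(* Doubling the midpoint inequality turns it into [ln (v^2) <= ln (u w)]. *)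
have turan (u v w : R) : 0 < u -> 0 < v -> 0 < w ->
    ln v <= 2^-1 * ln u + (1 - 2^-1) * ln w -> 0 <= u * w - v ^+ 2.
  move=> u0 v0 w0 uvw.
  rewrite subr_ge0 -ler_ln ?posrE ?exprn_gt0 ?mulr_gt0// lnM// lnXn//.
  by rewrite -mulr_natr; lra.
exact: turan (W0 A A0) (W0 _ A1) (W0 _ A2).
Qed.
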